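(* Let $n\ge1$, $\mathcal{M}=\{1^{k_1},\ldots,n^{k_n}\}$ with all $k_i\ge1$, and $K=k_1+\cdots+k_n$. For every integer $m\ge0$, $$|\mathcal{BT}_{\mathcal{M},m}|=\frac{m^n}{K-n+1}\binom{K-n+m}{m}.$$
   Context: $\mathcal{M}$ is the multiset in which $i$ occurs exactly $k_i$ times. An ordered tree is a rooted tree whose children at each vertex are linearly ordered left to right; the level of a vertex is its distance from the root. $\mathcal{BT}_{\mathcal{M},m}$ is the set of ordered trees such that: (i) vertices are labeled by the multiset $\{0\}\cup\mathcal{M}$ (each label used exactly as often as its multiplicity), except that some leaves at odd level may be unlabeled; (ii) the root is labeled $0$; (iii) each labeled odd-level vertex with label $i$ has exactly $k_i-1$ children, all labeled $i$; (iv) for each internal vertex $v$ at even level, the sequence of children of $v$ is divided into consecutive blocks, each block being either a single unlabeled leaf or a nonempty set of labeled children whose labels increase from left to right; and the total number of blocks (over all even-level internal vertices) is $m$. Trees are counted up to label-and-block-preserving isomorphism of ordered trees. *)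

(* Defs.v *)
From mathcomp Require Import all_boot all_algebra.
From mathcomp Require Import boolp classical_sets cardinality.

Set Implicit Arguments.
Unset Strict Implicit.
Unset Printing Implicit Defensive.

(* A finite ordered tree whose vertices may carry a label and a division of
   their children into consecutive blocks. The division is recorded as the
   sequence of block sizes, from left to right; the empty sequence stands for
   "not divided" at odd levels. Since children are kept in a list, two terms
   are equal exactly when the trees they denote are isomorphic as labeled
   ordered trees with blocks. *)
Inductive tree := Node of option nat & seq nat & seq tree.

Definition label (v : tree) : option nat := let: Node a _ _ := v in a.
Definition division (v : tree) : seq nat := let: Node _ d _ := v in d.
Definition children (v : tree) : seq tree := let: Node _ _ c := v in c.

Definition leaf (v : tree) : bool := nilp (children v).
Definition labeled (v : tree) : bool := isSome (label v).

Definition blocks (v : tree) : seq (seq tree) :=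
  reshape (division v) (children v).

(* A vertex is represented by its level paired with the subtree rooted at it. *)
Fixpoint vertices_from (l : nat) (t : tree) : seq (nat * tree) :=
  let: Node _ _ c := t in
  (l, t) :: flatten [seq vertices_from l.+1 u | u <- c].

Definition vertices (t : tree) : seq (nat * tree) := vertices_from 0 t.

Definition labels (t : tree) : seq nat := pmap (fun v => label v.2) (vertices t).

(* The multiset {1^{k 1}, ..., n^{k n}}, as a sequence up to permutation. *)
Definition multiset (n : nat) (k : nat -> nat) : seq nat :=
  flatten [seq nseq (k i) i | i <- iota 1 n].

Definition valid_labels (n : nat) (k : nat -> nat) (t : tree) : bool :=
  perm_eq (labels t) (0 :: multiset n k) &&
  all (fun v => labeled v.2 || (odd v.1 && leaf v.2)) (vertices t).

Definition valid_root (t : tree) : bool := label t == Some 0.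

Definition valid_odd (k : nat -> nat) (v : tree) : bool :=
  nilp (division v) &&
  (if label v is Some i
   then [seq label u | u <- children v] == nseq (k i - 1) (Some i)
   else true).

Definition valid_block (b : seq tree) : bool :=
  (if b is [:: u] then ~~ labeled u && leaf u else false) ||
  [&& ~~ nilp b, all labeled b & sorted ltn (pmap label b)].

(* The first condition says that the block sizes exhaust the children; as
   valid blocks are nonempty, a leaf is only allowed the empty division. *)
Definition valid_even (v : tree) : bool :=
  (sumn (division v) == size (children v)) && all valid_block (blocks v).

Definition valid_vertex (k : nat -> nat) (v : nat * tree) : bool :=
  if odd v.1 then valid_odd k v.2 else valid_even v.2.

Definition nb_blocks (t : tree) : nat :=
  \sum_(v <- vertices t | ~~ odd v.1 && ~~ leaf v.2) size (blocks v.2).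

Definition BT (n : nat) (k : nat -> nat) (m : nat) : set tree :=
  [set t | [/\ valid_labels n k t, valid_root t,
               all (valid_vertex k) (vertices t) & nb_blocks t = m]]%classic.

(* Main.v *)
Require Import Defs.
From mathcomp Require Import all_boot all_algebra.
From mathcomp Require Import boolp classical_sets cardinality.
From mathcomp Require Import zify.

(* Write N = K - n. In a tree of BT each label i >= 1 occurs at exactly one odd
   vertex and at its k_i - 1 children, so there are N + 1 even vertices. Reading
   the even vertices in preorder, and recording for each the sequence of the label
   sets of its blocks (the empty set for an unlabeled leaf), turns the tree into a
   word of N + 1 letters with m blocks in total, in which the blocks distribute
   1, ..., n. If the weight of a letter is the sum of k_i - 1 over its labels, the
   trees correspond exactly to the Lukasiewicz words, those for which the traversal
   never runs out of pending vertices before the end. There are m^n C(N + m, m)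
   words in all: place m blocks at N + 1 vertices, then choose the block of each
   label. As the total weight is N, the cycle lemma says that exactly one of the
   N + 1 rotations of each word is a Lukasiewicz word. *)

(** * The cycle lemma *)

(* [r] counts the trees of the forest that are still to be read; a letter of
   weight [x] replaces one pending tree by [x] new ones. *)
Fixpoint lukasiewicz (r : nat) (s : seq nat) : bool :=
  if s is x :: s' then (0 < r) && lukasiewicz (r.-1 + x) s' else r == 0.

(** Before letter [j] is read, [sumn (take j s) + r - j] trees are pending; this must be positive at
    every letter and zero at the end. *)
Lemma lukasiewiczP (r : nat) (s : seq nat) :
  reflect (sumn s + r = size s /\
           forall j, j < size s -> j < sumn (take j s) + r)
          (lukasiewicz r s).
Proof.
apply: (iffP idP); elim: s r => [|x s IHs] r /=.
- by move/eqP ->.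
- case/andP=> r_gt0 /IHs[sum_s lt_s]; split; first by lia.
  by case=> [|j] /=; [lia | move=> /lt_s; lia].
- by case=> /eqP.
- case=> sum_s lt_s; have /= r_gt0 := lt_s 0 isT.
  rewrite r_gt0 IHs //; split; first by lia.
  by move=> j /(lt_s j.+1) /=; lia.
Qed.

(** A prefix of the rotation stays inside [drop r s] or wraps around; adding [sumn (take r s)] turns
    it into a prefix of the cyclic word read from position 0. *)
Lemma sumn_take_rot (s : seq nat) (r j : nat) : r <= size s -> j <= size s ->
  sumn (take j (rot r s)) + sumn (take r s) =
  if j + r <= size s then sumn (take (j + r) s)
  else sumn s + sumn (take (j + r - size s) s).
Proof.
move=> le_r le_j; rewrite /rot take_cat size_drop.
case: ifP => [lt_j | /negbT]; last rewrite -leqNgt => le_j'.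
  by rewrite ifT 1?addnC -?sumn_cat -?takeD 1?addnC //; lia.
rewrite sumn_cat addnAC.
have -> : sumn (drop r s) + sumn (take r s) = sumn s.
  by rewrite addnC -sumn_cat cat_take_drop.
rewrite take_takel; last lia.
have -> : j - (size s - r) = j + r - size s by lia.
case: ifP => // le_jr; have -> : j + r = size s by lia.
by rewrite subnn take0 take_size /= addn0.
Qed.

(* The good rotation starts at the first minimum of [j |-> sumn (take j s) - j]. *)
Lemma lukasiewicz_rotP (s : seq nat) (r : nat) :
  sumn s + 1 = size s -> r < size s ->
  reflect (forall j, j < size s ->
             (j < r -> sumn (take r s) + j < sumn (take j s) + r) /\
             (r < j -> sumn (take r s) + j <= sumn (take j s) + r))
          (lukasiewicz 1 (rot r s)).
Proof.
move=> sum_s lt_r.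
have sum_rot : sumn (rot r s) = sumn s by apply/perm_sumn; rewrite perm_rot.
have PE j := @sumn_take_rot s r j (ltnW lt_r).
apply: (iffP (lukasiewiczP _ _)) => [[_]|] H; rewrite ?size_rot in H *.
  move=> j lt_j; split=> lt_jr.
    (* Position [j < r] of [s] lands at [j + size s - r] in the rotated word. *)
    have lt_i : j + size s - r < size s by lia.
    have := H _ lt_i; have := PE _ (ltnW lt_i).
    have -> : j + size s - r + r = j + size s by lia.
    rewrite addnK; case: ifP => [|_]; last by lia.
    rewrite -{2}[size s]add0n leq_add2r leqn0 => /eqP ->.
    by rewrite add0n take0 take_size /=; lia.
  have lt_i : j - r < size s by lia.
  have := H _ lt_i; have := PE _ (ltnW lt_i).
  by rewrite subnK ?(ltnW lt_j) ?(ltnW lt_jr) //; lia.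
split=> [|j lt_j]; first by rewrite sum_rot.
have := PE _ (ltnW lt_j).
have [-> | j_gt0] := posnP j; first by lia.
case: ifP => [le_jr | /negbT]; last rewrite -ltnNge => lt_jr.
  (* A prefix that stops at the end of [s] is compared with position 0: a full turn lowers
     [sumn (take j s) - j] by 1. *)
  have [e | ne] := eqVneq (j + r) (size s).
    rewrite e take_size.
    have [r0 | r_gt0] := posnP r; first by lia.
    have [/(_ r_gt0) + _] := H 0 ltac:(lia).
    by rewrite take0 /=; lia.
  by have [_ /(_ ltac:(lia))] := H (j + r) ltac:(lia); lia.
by have [/(_ ltac:(lia)) + _] := H (j + r - size s) ltac:(lia); lia.
Qed.

Lemma cycle_lemma (s : seq nat) : sumn s + 1 = size s ->
  \sum_(r < size s) lukasiewicz 1 (rot r s) = 1.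
Proof.
move=> sum_s; have L_gt0 : 0 < size s by lia.
(* Adding [size s] avoids truncation. As [i < size s], minimizing [D i * size s + i] is
   lexicographic and picks the first minimum of [D]. *)
pose D j := sumn (take j s) + size s - j.
pose i0 := Ordinal L_gt0.
case: (@arg_minnP _ i0 xpredT (fun i : 'I_(size s) => D i * size s + i)) => // r _ min_r.
have lt_r := ltn_ord r.
have luk_r : lukasiewicz 1 (rot r s).
  apply/lukasiewicz_rotP => // j lt_j.
  have := min_r (Ordinal lt_j) isT; rewrite /= /D; split=> lt_jr.
    by rewrite ltnNge; apply/negP => le_D; nia.
  by rewrite leqNgt; apply/negP => lt_D; nia.
rewrite (bigD1 r) //= luk_r big1 // => r' ne_r'; have lt_r' := ltn_ord r'.
apply/eqP; rewrite eqb0; apply: contraNN ne_r' => luk_r'; apply/eqP/val_inj => /=.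
(* If two rotations are good, the later position is strictly lower than the earlier one, which
   goodness of the earlier one forbids. *)
have /lukasiewicz_rotP-/(_ sum_s lt_r)/(_ r' lt_r')[lt1 lt2] := luk_r.
have /lukasiewicz_rotP-/(_ sum_s lt_r')/(_ r lt_r)[lt3 lt4] := luk_r'.
case: (ltngtP r' r) => // lt_rr.
  by have := lt1 lt_rr; have := lt4 lt_rr; lia.
by have := lt2 lt_rr; have := lt3 lt_rr; lia.
Qed.

(** * Trees as words *)

Definition grandchildren (t : tree) : seq tree :=
  flatten [seq children u | u <- children t].

(* An unlabeled leaf is a block without labels, hence reads as [::]. *)
Definition letter (t : tree) : seq (seq nat) :=
  [seq pmap label b | b <- blocks t].

(** The inner match on the odd-level children makes the jump to grandchildren a structural
    recursion. *)
Fixpoint tree_word (t : tree) : seq (seq (seq nat)) :=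
  let: Node _ _ c := t in
  letter t :: flatten [seq (let: Node _ _ c' := u in
                            flatten [seq tree_word v | v <- c']) | u <- c].

Definition encode (F : seq tree) : seq (seq (seq nat)) :=
  flatten [seq tree_word t | t <- F].

(* This makes [encode] a depth-first traversal with a stack: the grandchildren of
   the vertex just read are pushed in front of the pending trees. *)
Lemma encode_cons (t : tree) (F : seq tree) :
  encode (t :: F) = letter t :: encode (grandchildren t ++ F).
Proof.
rewrite /encode map_cat flatten_cat /grandchildren map_flatten.
case: t => a d c /=; congr (_ :: (_ ++ _)).
by elim: c => //= -[a' d' c'] c IHc /=; rewrite flatten_cat IHc.
Qed.

(** Each step consumes one letter of [encode F], so the induction is well-founded even though the
    forest itself may grow. *)
Lemma forest_ind (P : seq tree -> Prop) :
  P [::] -> (forall t F, P (grandchildren t ++ F) -> P (t :: F)) ->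
  forall F, P F.
Proof.
move=> P0 Pcons F; have [s] := ubnP (size (encode F)).
elim: s F => // s IHs [//|t F]; rewrite encode_cons ltnS => lt_s.
exact/Pcons/IHs.
Qed.

Definition forest_vertices (F : seq tree) : seq (nat * tree) :=
  flatten [seq vertices t | t <- F].

Lemma vertices_fromSS (l : nat) (t : tree) :
  vertices_from l.+2 t = [seq (v.1.+2, v.2) | v <- vertices_from l t].
Proof.
move: l t; fix IH 2 => l [a d c] /=; congr (_ :: _).
rewrite map_flatten -map_comp; congr flatten.
by elim: c => //= u c ->; rewrite IH.
Qed.

(* The additive statistics of a forest satisfy the recursion of [encode_cons];
   the hypothesis says that [g] sees only the parity of the level. *)
Lemma big_forest_vertices (T : Type) (idx : T) (op : Monoid.com_law idx)
    (g : nat * tree -> T) (t : tree) (F : seq tree) :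
  (forall l u, g (l.+2, u) = g (l, u)) ->
  \big[op/idx]_(v <- forest_vertices (t :: F)) g v =
  op (g (0, t)) (op (\big[op/idx]_(u <- children t) g (1, u))
                    (\big[op/idx]_(v <- forest_vertices (grandchildren t ++ F)) g v)).
Proof.
move=> gSS; have g2 u : \big[op/idx]_(v <- vertices_from 2 u) g v =
                        \big[op/idx]_(v <- vertices u) g v.
  by rewrite vertices_fromSS big_map; apply: eq_bigr => -[l v] _; rewrite gSS.
rewrite /forest_vertices map_cat flatten_cat /= !big_cat /=.
case: t => a d c; rewrite /= big_cons -!Monoid.mulmA; congr (op _ _).
rewrite Monoid.mulmA; congr (op _ _); rewrite /grandchildren /=.
rewrite !big_flatten /= !big_map !big_flatten /= big_map -big_split /=.
apply: eq_bigr => -[a' d' c'] _ /=; rewrite big_cons; congr (op _ _).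
by rewrite big_flatten big_map; apply: eq_bigr => u _; rewrite g2.
Qed.

(** Gathers the conditions of [BT] that concern a single vertex; they depend only on the parity of
    its level, as [big_forest_vertices] requires. *)
Definition well_formed (k : nat -> nat) (v : nat * tree) : bool :=
  valid_vertex k v && (labeled v.2 || odd v.1 && leaf v.2).

Definition well_formed_forest (k : nat -> nat) (F : seq tree) : bool :=
  all (well_formed k) (forest_vertices F).

Lemma well_formed_cons (k : nat -> nat) (t : tree) (F : seq tree) :
  well_formed_forest k (t :: F) =
  [&& well_formed k (0, t), all (fun u => well_formed k (1, u)) (children t)
    & well_formed_forest k (grandchildren t ++ F)].
Proof.
rewrite /well_formed_forest -!big_all big_forest_vertices // => l u.
by rewrite /well_formed /valid_vertex /= negbK.
Qed.

(** * Odd-level vertices *)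

Definition child_labels (k : nat -> nat) (l : option nat) : seq nat :=
  if l is Some i then nseq (k i - 1) i else [::].

(** An unlabeled odd-level vertex must be a leaf, so in both cases the label of the vertex fixes the
    labels of its children. *)
Lemma well_formed_oddE (k : nat -> nat) (u : tree) :
  well_formed k (1, u) =
  nilp (division u) && ([seq label v | v <- children u] ==
                        [seq Some i | i <- child_labels k (label u)]).
Proof.
rewrite /well_formed /valid_vertex /= /valid_odd /labeled /leaf.
case: (label u) => [i|] /=; first by rewrite map_nseq andbT.
by rewrite andbT; case: (children u).
Qed.

Lemma odd_grandchildren_labels (k : nat -> nat) (c : seq tree) :
  all (fun u => well_formed k (1, u)) c ->
  [seq label v | v <- flatten [seq children u | u <- c]] =
  [seq Some i | i <- flatten [seq child_labels k (label u) | u <- c]].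
Proof.
elim: c => //= u c IHc /andP[]; rewrite well_formed_oddE => /andP[_ /eqP lab_u] /IHc.
by rewrite !map_cat lab_u => ->.
Qed.

(** The labels fix the number of children of each vertex, hence where the concatenated list of
    children is cut. *)
Lemma odd_vertices_inj (k : nat -> nat) (c1 c2 : seq tree) :
  all (fun u => well_formed k (1, u)) c1 ->
  all (fun u => well_formed k (1, u)) c2 ->
  map label c1 = map label c2 ->
  flatten [seq children u | u <- c1] = flatten [seq children u | u <- c2] ->
  c1 = c2.
Proof.
elim: c1 c2 => [|u1 c1 IHc] [|u2 c2] //=.
rewrite !well_formed_oddE => /andP[/andP[/nilP d1 /eqP ch1] wf1].
move=> /andP[/andP[/nilP d2 /eqP ch2] wf2] [lab_u lab_c] eq_ch.
rewrite -lab_u -ch1 in ch2; have sz_ch := congr1 size ch2; rewrite !size_map in sz_ch.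
have := congr1 (take (size (children u1))) eq_ch.
rewrite take_size_cat // -sz_ch take_size_cat // => eq_ch1.
have := congr1 (drop (size (children u1))) eq_ch.
rewrite drop_size_cat // -sz_ch drop_size_cat // => eq_ch2.
rewrite (IHc c2) //; case: u1 u2 d1 d2 lab_u eq_ch1 {ch1 ch2 sz_ch eq_ch}.
by move=> a1 d1 ? [a2 d2 ?] /= -> -> -> ->.
Qed.

(** Cut [G] into pieces of the lengths that the labels prescribe, and put each piece under its
    vertex. *)
Lemma odd_vertices_exist (k : nat -> nat) (ls : seq (option nat)) (G : seq tree) :
  map label G = [seq Some i | i <- flatten [seq child_labels k l | l <- ls]] ->
  exists c, [/\ map label c = ls, all (fun u => well_formed k (1, u)) c &
                flatten [seq children u | u <- c] = G].
Proof.
elim: ls G => [|l ls IHls] G /=; first by case: G => // _; exists [::].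
rewrite map_cat; set s := size (child_labels k l) => lab_G.
have lab_take : map label (take s G) = [seq Some i | i <- child_labels k l].
  by rewrite map_take lab_G take_size_cat ?size_map.
have := congr1 (drop s) lab_G; rewrite drop_size_cat ?size_map // -map_drop.
case/IHls=> c [lab_c wf_c ch_c]; exists (Node l [::] (take s G) :: c).
by rewrite /= lab_c ch_c cat_take_drop well_formed_oddE /= lab_take eqxx.
Qed.

(** * Even-level vertices and their letters *)

Definition block_labels (s : seq nat) : seq (option nat) :=
  if s is [::] then [:: None] else map Some s.

Lemma pmap_label (b : seq tree) : pmap label b = pmap id (map label b).
Proof. by elim: b => //= u b ->. Qed.

Lemma pmap_block_labels (s : seq nat) : pmap id (block_labels s) = s.
Proof. by case: s => //= i s; elim: s => //= j s [->]. Qed.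

Lemma valid_blockP (k : nat -> nat) (b : seq tree) (s : seq nat) :
  all (fun u => well_formed k (1, u)) b -> sorted ltn s ->
  map label b = block_labels s -> valid_block b.
Proof.
move=> wf_b sorted_s lab_b; rewrite /valid_block.
have -> : pmap label b = s by rewrite pmap_label lab_b pmap_block_labels.
rewrite sorted_s; case: s lab_b {sorted_s} => [|i s] /= lab_b.
  (* Here [s] is empty, so [b] is one unlabeled vertex, and well-formedness makes it a leaf. *)
  case: b wf_b lab_b => [|u [|? ?]] //= /andP[+ _] [lab_u].
  rewrite well_formed_oddE; case: u lab_u => a d [|v c] /= ->; first by [].
  by rewrite andbF.
rewrite orbC andbT; case: b lab_b {wf_b} => //= u b [lab_u lab_b].
rewrite {1}/labeled lab_u /=; suff -> : all labeled b by [].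
by elim: b s lab_b => //= v b IHb [|j s] //= [lab_v /IHb ->]; rewrite /labeled lab_v.
Qed.

Lemma valid_block_labels (b : seq tree) :
  valid_block b -> map label b = block_labels (pmap label b).
Proof.
rewrite /valid_block => /orP[|/and3P[]].
  by case: b => [|u [|? ?]] //=; rewrite /labeled; case: (label u).
case: b => //= u b _; rewrite {1}/labeled; case: (label u) => //= i lab_b _.
congr (_ :: _); elim: b lab_b => //= v b IHb; rewrite {1}/labeled.
by case: (label v) => //= j /IHb ->.
Qed.

Lemma valid_block_sorted (b : seq tree) : valid_block b -> sorted ltn (pmap label b).
Proof.
rewrite /valid_block => /orP[|/and3P[]] //.
by case: b => [|u [|? ?]] //=; rewrite /labeled; case: (label u).
Qed.

Lemma well_formed_evenE (k : nat -> nat) (t : tree) :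
  well_formed k (0, t) =
  [&& labeled t, sumn (division t) == size (children t) & all valid_block (blocks t)].
Proof. by rewrite /well_formed /valid_vertex /= orbF andbC. Qed.

Lemma map_label_children (k : nat -> nat) (t : tree) : well_formed k (0, t) ->
  map label (children t) = flatten (map block_labels (letter t)).
Proof.
rewrite well_formed_evenE => /and3P[_ /eqP sum_d valid_t].
have {1}<- : flatten (blocks t) = children t by rewrite reshapeKr ?sum_d.
rewrite /letter; elim: (blocks t) valid_t => //= b B IHB /andP[/valid_block_labels lab_b].
by move=> /IHB; rewrite map_cat lab_b => ->.
Qed.

(** [block_labels] expands an empty set to one unlabeled child, so block sizes can be read off the
    letter. *)
Lemma division_letter (k : nat -> nat) (t : tree) : well_formed k (0, t) ->
  division t = map size (map block_labels (letter t)).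
Proof.
rewrite well_formed_evenE => /and3P[_ /eqP sum_d valid_t].
have {1}<- : shape (blocks t) = division t by rewrite reshapeKl ?sum_d.
rewrite /letter; elim: (blocks t) valid_t => //= b B IHB /andP[/valid_block_labels lab_b].
by move=> /IHB <-; rewrite -lab_b size_map.
Qed.

(** The letter yields the division and the labels of the children; [odd_vertices_inj] then
    distributes the grandchildren among them. *)
Lemma even_vertex_inj (k : nat -> nat) (t1 t2 : tree) :
  well_formed k (0, t1) -> all (fun u => well_formed k (1, u)) (children t1) ->
  well_formed k (0, t2) -> all (fun u => well_formed k (1, u)) (children t2) ->
  label t1 = label t2 -> letter t1 = letter t2 ->
  grandchildren t1 = grandchildren t2 -> t1 = t2.
Proof.
move=> wf1 wfc1 wf2 wfc2 eq_lab eq_let eq_gc.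
have eq_div : division t1 = division t2.
  by rewrite (division_letter _ _ wf1) (division_letter _ _ wf2) eq_let.
have : children t1 = children t2.
  apply: (odd_vertices_inj k) => //.
  by rewrite (map_label_children _ _ wf1) (map_label_children _ _ wf2) eq_let.
by case: t1 t2 eq_lab eq_div {wf1 wfc1 wf2 wfc2 eq_let eq_gc} => ? ? ? [? ? ?] /= -> -> ->.
Qed.

(* The labels of the grandchildren of an even-level vertex with letter [a]. *)
Definition new_labels (k : nat -> nat) (a : seq (seq nat)) : seq nat :=
  flatten [seq nseq (k i - 1) i | i <- flatten a].

Lemma child_labels_block_labels (k : nat -> nat) (a : seq (seq nat)) :
  flatten [seq child_labels k l | l <- flatten (map block_labels a)] = new_labels k a.
Proof.
rewrite /new_labels; elim: a => //= s a IHa; rewrite !map_cat !flatten_cat IHa.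
by case: s => //= i s; rewrite -map_comp.
Qed.

Lemma grandchildren_labels (k : nat -> nat) (t : tree) :
  well_formed k (0, t) -> all (fun u => well_formed k (1, u)) (children t) ->
  map label (grandchildren t) = map Some (new_labels k (letter t)).
Proof.
move=> wf_t /odd_grandchildren_labels ->.
by rewrite -child_labels_block_labels -(map_label_children k) // -map_comp.
Qed.

Lemma all_flatten (T : Type) (p : pred T) (ss : seq (seq T)) :
  all p (flatten ss) = all (all p) ss.
Proof. by elim: ss => //= s ss IHss; rewrite all_cat IHss. Qed.

(** [odd_vertices_exist] builds the children above [G], and the division takes its sizes from
    [block_labels]. The label [i] of the vertex itself is free. *)
Lemma even_vertex_exists (k : nat -> nat) (i : nat) (a : seq (seq nat)) (G : seq tree) :
  all (sorted ltn) a -> map label G = map Some (new_labels k a) ->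
  exists t, [/\ label t = Some i, letter t = a, grandchildren t = G,
     well_formed k (0, t) & all (fun u => well_formed k (1, u)) (children t)].
Proof.
move=> sorted_a; rewrite -child_labels_block_labels.
case/odd_vertices_exist=> c [lab_c wf_c gc_c].
pose d := shape (map block_labels a).
have sum_d : sumn d = size c by rewrite -size_flatten -lab_c size_map.
have lab_B : map (map label) (reshape d c) = map block_labels a.
  by rewrite map_reshape lab_c flattenK.
exists (Node (Some i) d c); split=> //.
  rewrite /letter /blocks /=.
  rewrite (eq_map (pmap_label : pmap label =1 pmap id \o map label)).
  rewrite map_comp lab_B -map_comp -[RHS]map_id; apply: eq_map.
  exact: pmap_block_labels.
rewrite well_formed_evenE /= sum_d eqxx /= /blocks /=.
have : all (all (fun u => well_formed k (1, u))) (reshape d c).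
  by rewrite -all_flatten reshapeKr ?sum_d.
move: (reshape d c) lab_B => B; elim: a B sorted_a {d sum_d lab_c} => [|s a IHa] [|b B] //=.
move=> /andP[sorted_s sorted_a] [lab_b lab_B] /andP[wf_b wf_B].
by rewrite (valid_blockP _ _ _ wf_b sorted_s) // IHa.
Qed.

(** * Forests and Lukasiewicz words *)

Definition weight (k : nat -> nat) (a : seq (seq nat)) : nat :=
  sumn [seq k i - 1 | i <- flatten a].

Lemma size_new_labels (k : nat -> nat) (a : seq (seq nat)) :
  size (new_labels k a) = weight k a.
Proof.
rewrite size_flatten /shape -map_comp; congr sumn.
by apply: eq_map => i /=; rewrite size_nseq.
Qed.

(** The forest is the stack of pending trees: reading [t] replaces it by its grandchildren, whose
    number is the weight of its letter. *)
Lemma encode_lukasiewicz (k : nat -> nat) (F : seq tree) :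
  well_formed_forest k F -> lukasiewicz (size F) (map (weight k) (encode F)).
Proof.
elim/forest_ind: F => // t F IHF; rewrite well_formed_cons => /and3P[wf_t wf_c /IHF].
rewrite encode_cons /= size_cat addnC -[size (grandchildren t)](size_map label).
by rewrite (grandchildren_labels k) // size_map size_new_labels.
Qed.

Lemma encode_sorted (k : nat -> nat) (F : seq tree) :
  well_formed_forest k F -> all (all (sorted ltn)) (encode F).
Proof.
elim/forest_ind: F => // t F IHF; rewrite well_formed_cons => /and3P[wf_t _ /IHF].
rewrite encode_cons /= => ->; rewrite andbT /letter.
move: wf_t; rewrite well_formed_evenE => /and3P[_ _]; rewrite all_map.
by apply: sub_all => b; apply: valid_block_sorted.
Qed.

(** Root labels do not appear in the word, hence the hypothesis on them. Equal first letters give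
    equally many grandchildren with equal labels, so the induction carries over to the new stack. *)
Lemma encode_inj (k : nat -> nat) (F1 F2 : seq tree) :
  well_formed_forest k F1 -> well_formed_forest k F2 ->
  map label F1 = map label F2 -> encode F1 = encode F2 -> F1 = F2.
Proof.
elim/forest_ind: F1 F2 => [|t1 F1 IHF] [|t2 F2] //.
rewrite !well_formed_cons !encode_cons => /and3P[wf1 wfc1 wfF1] /and3P[wf2 wfc2 wfF2].
case=> lab_t lab_F [eq_let eq_enc].
have lab1 := grandchildren_labels _ _ wf1 wfc1.
have lab2 := grandchildren_labels _ _ wf2 wfc2.
have lab_gc : map label (grandchildren t1) = map label (grandchildren t2).
  by rewrite lab1 lab2 eq_let.
have sz_gc := congr1 size lab_gc; rewrite !size_map in sz_gc.
have eq_F : grandchildren t1 ++ F1 = grandchildren t2 ++ F2.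
  by apply: IHF => //; rewrite !map_cat lab_gc lab_F.
have := congr1 (take (size (grandchildren t1))) eq_F.
have := congr1 (drop (size (grandchildren t1))) eq_F.
rewrite take_size_cat // drop_size_cat // sz_gc take_size_cat // drop_size_cat //.
by move=> -> eq_gc; congr (_ :: _); apply: (even_vertex_inj k).
Qed.

(** Decoding recurses on the word, with [ls] holding the labels of the pending roots. *)
Lemma encode_surj (k : nat -> nat) (ls : seq nat) (w : seq (seq (seq nat))) :
  lukasiewicz (size ls) (map (weight k) w) -> all (all (sorted ltn)) w ->
  exists F, [/\ well_formed_forest k F, map label F = map Some ls & encode F = w].
Proof.
elim: w ls => [|a w IHw] [|i ls] //=; first by exists [::].
(* The stack for the tail is [new_labels k a ++ ls]; its first part will become the grandchildren of
   the tree being built. *)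
rewrite addnC -size_new_labels -size_cat => luk_w /andP[sorted_a sorted_w].
have [F [wf_F lab_F enc_F]] := IHw _ luk_w sorted_w.
pose s := size (new_labels k a).
have lab_take : map label (take s F) = map Some (new_labels k a).
  by rewrite map_take lab_F map_cat take_size_cat ?size_map.
have lab_drop : map label (drop s F) = map Some ls.
  by rewrite map_drop lab_F map_cat drop_size_cat ?size_map.
have [t [lab_t let_t gc_t wf_t wf_c]] := even_vertex_exists _ i _ _ sorted_a lab_take.
exists (t :: drop s F); rewrite encode_cons well_formed_cons gc_t cat_take_drop.
by rewrite let_t enc_F wf_t wf_c wf_F /= lab_t lab_drop.
Qed.

(** * Label multiplicities and block numbers read from the word *)

Lemma count_block_labels (i : nat) (a : seq (seq nat)) :
  count_mem (Some i) (flatten (map block_labels a)) = count_mem i (flatten a).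
Proof.
elim: a => //= s a IHa; rewrite !count_cat IHa; congr (_ + _).
by case: s => //= j s; rewrite count_map.
Qed.

Lemma count_flatten_nseq (k : nat -> nat) (i : nat) (s : seq nat) :
  count_mem i (flatten [seq nseq (k j) j | j <- s]) = k i * count_mem i s.
Proof.
elim: s => [|j s IHs] /=; first by rewrite muln0.
rewrite count_cat IHs count_nseq mulnDr /=.
by have [->|_] := eqVneq j i; rewrite ?mul1n ?muln1 ?mul0n ?muln0.
Qed.

Lemma count_new_labels (k : nat -> nat) (i : nat) (a : seq (seq nat)) :
  count_mem i (new_labels k a) = (k i - 1) * count_mem i (flatten a).
Proof. exact: (count_flatten_nseq (fun i => k i - 1)). Qed.

(** Apart from the roots, each occurrence of [i] in a letter accounts for one odd-level vertex and
    its [k i - 1] children. The factor is not simplified to [k i], which could be 0 here. *)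
Lemma count_forest_labels (k : nat -> nat) (i : nat) (F : seq tree) :
  well_formed_forest k F ->
  \sum_(v <- forest_vertices F) (label v.2 == Some i) =
  count_mem (Some i) (map label F) +
  (k i - 1).+1 * count_mem i (flatten (flatten (encode F))).
Proof.
elim/forest_ind: F => [|t F IHF]; first by rewrite big_nil muln0.
rewrite well_formed_cons => /and3P[wf_t wf_c wf_F].
rewrite big_forest_vertices //= IHF // encode_cons /= flatten_cat map_cat !count_cat.
rewrite (grandchildren_labels k) // count_map (@eq_count _ _ (pred1 i)) //.
have -> : \sum_(u <- children t) (label u == Some i) = count_mem i (flatten (letter t)).
  rewrite -count_block_labels -(map_label_children _ _ wf_t).
  by rewrite count_map -sum1_count [RHS]big_mkcond.
rewrite count_new_labels -!addnA; congr (_ + _).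
move: (k i - 1) (count_mem i (flatten (letter t))) => p q.
by move: (count _ (flatten _)) (count _ _) => x y; lia.
Qed.

Lemma nb_blocks_forest (k : nat -> nat) (F : seq tree) :
  well_formed_forest k F ->
  \sum_(v <- forest_vertices F | ~~ odd v.1 && ~~ leaf v.2) size (blocks v.2) =
  sumn (map size (encode F)).
Proof.
elim/forest_ind: F => [|t F IHF]; first by rewrite big_nil.
rewrite well_formed_cons => /and3P[wf_t _ wf_F].
rewrite big_mkcond big_forest_vertices /=; last by move=> l u; rewrite negbK.
rewrite -big_mkcond /= IHF // encode_cons /= big1_eq add0n; congr (_ + _).
rewrite size_map /leaf; move: wf_t; rewrite well_formed_evenE => /and3P[_ _].
(* For a leaf, any entry in the division would create an empty, hence invalid, block; so a leaf
   contributes 0. *)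
rewrite /blocks; case: (children t) => //=.
by case: (division t) => //= x d.
Qed.

(** * Counting words *)

(** Ordinals start at 0 and labels at 1, hence the successor. *)
Definition fibers (n m : nat) (f : {ffun 'I_n -> 'I_m}) : seq (seq nat) :=
  [seq [seq (val i).+1 | i <- enum 'I_n & f i == j] | j <- enum 'I_m].

Lemma size_fibers (n m : nat) (f : {ffun 'I_n -> 'I_m}) : size (fibers n m f) = m.
Proof. by rewrite size_map size_enum_ord. Qed.

Lemma nth_fibers (n m : nat) (f : {ffun 'I_n -> 'I_m}) (j : 'I_m) :
  nth [::] (fibers n m f) j = [seq (val i).+1 | i <- enum 'I_n & f i == j].
Proof. by rewrite (nth_map j) ?size_enum_ord // nth_ord_enum. Qed.

Lemma mem_fibers (n m : nat) (f : {ffun 'I_n -> 'I_m}) (i : 'I_n) (j : 'I_m) :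
  ((val i).+1 \in nth [::] (fibers n m f) j) = (f i == j).
Proof.
rewrite nth_fibers (mem_map (f := fun i : 'I_n => i.+1)).
  by rewrite mem_filter mem_enum andbT.
by move=> i1 i2 [/val_inj].
Qed.

Lemma fibers_inj (n m : nat) : injective (fibers n m).
Proof.
move=> f g eq_fg; apply/ffunP => i; apply/esym/eqP.
by rewrite -mem_fibers -eq_fg mem_fibers.
Qed.

Lemma fibers_sorted (n m : nat) (f : {ffun 'I_n -> 'I_m}) :
  all (sorted ltn) (fibers n m f).
Proof.
apply/allP => _ /mapP[j _ ->]; rewrite sorted_map; apply: sorted_filter.
  by move=> i1 i2 i3; apply: ltn_trans.
have : sorted ltn (map S (map val (enum 'I_n))).
  by rewrite val_enum_ord -(iotaDl 1) iota_ltn_sorted.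
by rewrite -map_comp sorted_map.
Qed.

Lemma perm_fibers (n m : nat) (f : {ffun 'I_n -> 'I_m}) :
  perm_eq (flatten (fibers n m f)) (iota 1 n).
Proof.
apply/permP => p; rewrite (iotaDl 1) -val_enum_ord -map_comp count_map.
rewrite count_flatten sumnE /fibers 2!big_map big_enum /= -sum1_count big_enum_cond /=.
rewrite (partition_big f xpredT) //=; apply: eq_bigr => j _.
by rewrite count_map count_filter -sum1_count big_enum_cond.
Qed.

(** Without repetitions in [flatten B], only one block can contain [x], so the search cannot stop
    earlier. *)
Lemma find_uniq_flatten (T : eqType) (B : seq (seq T)) (x : T) (j : nat) :
  uniq (flatten B) -> x \in nth [::] B j -> find (fun b => x \in b) B = j.
Proof.
elim: B j => [|b B IHB] j /=; first by rewrite nth_nil.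
rewrite cat_uniq => /and3P[_ /hasPn notin_b uniq_B].
case: j => [-> //|j] /= x_Bj.
have lt_j : j < size B.
  by rewrite ltnNge; apply/negP => le_j; rewrite nth_default in x_Bj.
rewrite (IHB j) //; have /notin_b/negbTE -> // : x \in flatten B.
by apply/flattenP; exists (nth [::] B j) => //; apply: mem_nth.
Qed.

(** The function sends each label to the index of the block where [find] locates it. *)
Lemma fibers_surj (n : nat) (B : seq (seq nat)) :
  all (sorted ltn) B -> perm_eq (flatten B) (iota 1 n) ->
  exists f : {ffun 'I_n -> 'I_(size B)}, fibers n (size B) f = B.
Proof.
move=> sorted_B perm_B.
have uniq_B : uniq (flatten B) by rewrite (perm_uniq perm_B) iota_uniq.
have lt_find (i : 'I_n) : find (fun b => (val i).+1 \in b) B < size B.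
  rewrite -has_find; apply/hasP.
  suff /flattenP[b b_B i_b] : (val i).+1 \in flatten B by exists b.
  by rewrite (perm_mem perm_B) mem_iota add1n /= !ltnS ltn_ord.
pose f := [ffun i => Ordinal (lt_find i)]; exists f.
apply: (@eq_from_nth _ [::]) => [|j]; rewrite size_fibers // => lt_j.
(* Strictly increasing blocks are equal as soon as they have the same members. *)
apply: (irr_sorted_eq ltn_trans ltnn).
- by move/allP: (fibers_sorted _ _ f); apply; apply: mem_nth; rewrite size_fibers.
- by move/allP: sorted_B; apply; apply: mem_nth.
have mem_f (i : 'I_n) : ((val i).+1 \in nth [::] (fibers _ _ f) j) =
                        ((val i).+1 \in nth [::] B j).
  rewrite (mem_fibers _ _ f i (Ordinal lt_j)) ffunE -val_eqE /=.
  apply/eqP/idP => [<- | /find_uniq_flatten -> //].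
  by apply: (@nth_find _ [::] (fun b => (val i).+1 \in b)); rewrite has_find.
have mem_ok C x : perm_eq (flatten C) (iota 1 n) -> j < size C ->
    x \in nth [::] C j -> exists i : 'I_n, x = (val i).+1.
  move=> perm_C lt_jC x_C; have : x \in iota 1 n.
    by rewrite -(perm_mem perm_C); apply/flattenP; exists (nth [::] C j) => //; apply: mem_nth.
  rewrite mem_iota add1n; case: x {x_C} => //= x lt_x.
  by exists (@Ordinal n x lt_x).
move=> x; apply/idP/idP => x_in.
  have [|i def_x] := mem_ok _ _ (perm_fibers _ _ f) _ x_in; first by rewrite size_fibers.
  by rewrite def_x -mem_f -def_x.
have [i def_x] := mem_ok _ _ perm_B lt_j x_in.
by rewrite def_x mem_f -def_x.
Qed.

(** Weak compositions of [m] into [N.+1] parts. No part exceeds [m], so tuples over ['I_m.+1] miss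
    none, and [card_ord_partitions] applies. *)
Definition compositions (N m : nat) : seq (seq nat) :=
  [seq map val (val t) |
   t <- enum [set t : N.+1.-tuple 'I_m.+1 | \sum_(i <- t) i == m]].

Lemma size_compositions (N m : nat) : size (compositions N m) = 'C(N + m, m).
Proof.
rewrite size_map -cardE card_ord_partitions -[in RHS]bin_sub ?leq_addl //.
by rewrite addnK.
Qed.

Lemma compositions_uniq (N m : nat) : uniq (compositions N m).
Proof.
rewrite map_inj_uniq ?enum_uniq // => t1 t2 /(inj_map val_inj) eq_t.
exact: val_inj.
Qed.

Lemma mem_compositions (N m : nat) (b : seq nat) :
  (b \in compositions N m) = (size b == N.+1) && (sumn b == m).
Proof.
apply/mapP/andP => [[t] | [size_b /eqP sum_b]].
  rewrite mem_enum inE => sum_t ->; rewrite size_map size_tuple eqxx.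
  by rewrite sumnE big_map.
have le_b x : x \in b -> x < m.+1.
  by move=> x_b; rewrite ltnS -sum_b sumnE (big_rem x x_b) leq_addr.
have size_t : size [seq inord x : 'I_m.+1 | x <- b] == N.+1 by rewrite size_map.
have val_t : [seq val x | x <- [seq inord x : 'I_m.+1 | x <- b]] = b.
  rewrite -map_comp -[RHS]map_id; apply/eq_in_map => x /le_b lt_x /=.
  by rewrite inordK.
exists (Tuple size_t); rewrite ?mem_enum ?inE //=.
by move: sum_b; rewrite -{1}val_t sumnE big_map => ->.
Qed.

Definition words (N n m : nat) : seq (seq (seq (seq nat))) :=
  [seq reshape b (fibers n m f)
     | b <- compositions N m, f <- enum {ffun 'I_n -> 'I_m}].

Lemma size_words (N n m : nat) : size (words N n m) = 'C(N + m, m) * m ^ n.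
Proof. by rewrite size_allpairs size_compositions -cardE card_ffun !card_ord. Qed.

(** [shape] and [flatten] undo [reshape], and [fibers_surj] recovers the function from the flattened
    word. *)
Lemma mem_words (N n m : nat) (w : seq (seq (seq nat))) :
  (w \in words N n m) =
  [&& size w == N.+1, sumn (map size w) == m, all (all (sorted ltn)) w
    & perm_eq (flatten (flatten w)) (iota 1 n)].
Proof.
apply/allpairsP/and4P => [[[b f] /= [+ _ ->]] | [size_w sum_w sorted_w perm_w]].
  rewrite mem_compositions => /andP[/eqP size_b /eqP sum_b].
  rewrite size_reshape size_b -all_flatten -/(shape _).
  rewrite reshapeKl ?reshapeKr ?size_fibers ?sum_b //.
  by rewrite fibers_sorted perm_fibers.
have size_fw : size (flatten w) = m by rewrite size_flatten; apply/eqP.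
rewrite -all_flatten in sorted_w.
have := fibers_surj _ _ sorted_w perm_w; rewrite size_fw => -[f def_f].
exists (shape w, f); rewrite /= def_f flattenK; split=> //; last by rewrite mem_enum.
by rewrite mem_compositions size_map size_w.
Qed.

Lemma words_uniq (N n m : nat) : uniq (words N n m).
Proof.
apply: allpairs_uniq; rewrite ?compositions_uniq ?enum_uniq //.
move=> _ _ /allpairsP[[b1 f1] /= [b1_in _ ->]] /allpairsP[[b2 f2] /= [b2_in _ ->]] /= eq_bf.
move: b1_in b2_in; rewrite !mem_compositions => /andP[_ /eqP sum1] /andP[_ /eqP sum2].
have := congr1 shape eq_bf; rewrite !reshapeKl ?size_fibers ?sum1 ?sum2 // => ->.
have := congr1 flatten eq_bf; rewrite !reshapeKr ?size_fibers ?sum1 ?sum2 //.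
by move/fibers_inj ->.
Qed.

(** All the conditions in [mem_words] are invariant under rotation, and rotation is injective. *)
Lemma rot_words (N n m r : nat) :
  perm_eq [seq rot r w | w <- words N n m] (words N n m).
Proof.
apply: uniq_perm; rewrite ?words_uniq ?map_inj_uniq ?words_uniq //; try exact: rot_inj.
have rot_mem s w : (rot s w \in words N n m) = (w \in words N n m).
  rewrite !mem_words size_rot map_rot (perm_sumn (permEl (perm_rot _ _))).
  rewrite (eq_all_r (mem_rot s w)); do 3 congr (_ && _).
  suff /permPl -> : perm_eq (flatten (flatten (rot s w))) (flatten (flatten w)) by [].
  by do 2![apply: perm_flatten]; rewrite perm_rot.
move=> w; rewrite -(rotrK r w) mem_map ?rot_mem //; exact: rot_inj.
Qed.

Definition good_words (N n : nat) (k : nat -> nat) (m : nat) :=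
  [seq w <- words N n m | lukasiewicz 1 (map (weight k) w)].

(** Each label occurs exactly once in the word, so the total weight does not depend on how the
    labels are distributed. *)
Lemma sum_weight (n : nat) (k : nat -> nat) (w : seq (seq (seq nat))) :
  perm_eq (flatten (flatten w)) (iota 1 n) ->
  sumn (map (weight k) w) = \sum_(1 <= i < n.+1) (k i - 1).
Proof.
move=> perm_w; rewrite /index_iota subn1 -(perm_big _ perm_w) /=.
rewrite 2!big_flatten /= sumnE big_map; apply: eq_bigr => a _.
by rewrite /weight sumnE big_map big_flatten.
Qed.

(* Double counting of the pairs (word, rotation making it good). *)
Lemma card_good_words (n : nat) (k : nat -> nat) (m : nat) :
  let N := \sum_(1 <= i < n.+1) (k i - 1) in
  N.+1 * size (good_words N n k m) = 'C(N + m, m) * m ^ n.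
Proof.
move=> N; rewrite -size_words size_filter.
pose good := fun w => lukasiewicz 1 (map (weight k) w).
(* By [rot_words], each fixed [r] yields the same number of words with a good rotation. *)
have -> : N.+1 * count good (words N n m) =
          \sum_(r < N.+1) \sum_(w <- words N n m) good (rot r w).
  rewrite -[X in X * _]card_ord -sum_nat_const; apply: eq_bigr => r _.
  rewrite -(permP (rot_words N n m r)) count_map -sum1_count big_mkcond /=.
  by apply: eq_bigr => w _; case: good.
rewrite exchange_big /= -sum1_size big_seq [RHS]big_seq; apply: eq_bigr => w.
rewrite mem_words => /and4P[/eqP size_w _ _ perm_w].
have sum_w : sumn (map (weight k) w) + 1 = size (map (weight k) w).
  by rewrite (sum_weight n) // size_map size_w addn1.
rewrite -(cycle_lemma _ sum_w) size_map size_w.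
by apply: eq_bigr => r _; rewrite /good map_rot.
Qed.

(** * Counting trees *)

(** Multiplicities are compared label by label through [count_forest_labels]; the initial 0 of the
    multiset is the root. *)
Lemma perm_labels (n : nat) (k : nat -> nat) (t : tree) :
  (forall i, 1 <= i <= n -> 1 <= k i) ->
  well_formed_forest k [:: t] -> label t = Some 0 ->
  perm_eq (labels t) (0 :: multiset n k) =
  perm_eq (flatten (flatten (encode [:: t]))) (iota 1 n).
Proof.
move=> k_ge1 wf_t lab_t; set L := flatten (flatten _).
have count_labels i : count_mem i (labels t) = (0 == i) + (k i - 1).+1 * count_mem i L.
  have := count_forest_labels k i _ wf_t.
  rewrite /= lab_t addn0 /forest_vertices /= cats0 => <-; rewrite /labels.
  elim: (vertices t) => [|v s IHs]; rewrite ?big_nil // big_cons -IHs /=.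
  by case: (label v.2).
have iff_count i : count_mem i (labels t) = count_mem i (0 :: multiset n k) <->
                   count_mem i L = count_mem i (iota 1 n).
  rewrite count_labels /= /multiset count_flatten_nseq.
  rewrite (count_uniq_mem i (iota_uniq 1 n)) mem_iota.
  (* For [i] between 1 and [n] the factor [(k i - 1).+1] equals [k i]; for any other [i] it is still
     positive, which forces multiplicity 0 in [L]. *)
  by have [/k_ge1|_] := boolP (1 <= i < 1 + n); nia.
apply/permP/permP => eq_count; apply/permP/allP => i _ /=; apply/eqP.
  by apply/iff_count; apply: eq_count.
by apply/iff_count; apply: eq_count.
Qed.

Lemma BT_good_words (n : nat) (k : nat -> nat) (m : nat) (t : tree) :
  (forall i, 1 <= i <= n -> 1 <= k i) ->
  BT n k m t <->
  [/\ well_formed_forest k [:: t], label t = Some 0 &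
      encode [:: t] \in good_words (\sum_(1 <= i < n.+1) (k i - 1)) n k m].
Proof.
move=> k_ge1; have vE : forest_vertices [:: t] = vertices t.
  by rewrite /forest_vertices /= cats0.
have wfE : well_formed_forest k [:: t] =
    all (valid_vertex k) (vertices t) &&
    all (fun v => labeled v.2 || (odd v.1 && leaf v.2)) (vertices t).
  by rewrite /well_formed_forest vE -all_predI.
rewrite /BT /valid_labels /valid_root /=; split.
  case=> /andP[perm_t lab_ok] /eqP lab_t valid_t nb_t.
  have wf_t : well_formed_forest k [:: t] by rewrite wfE valid_t.
  have perm_w := perm_t; rewrite perm_labels // in perm_w.
  have luk_w := encode_lukasiewicz _ _ wf_t.
  split=> //; rewrite mem_filter luk_w mem_words perm_w (encode_sorted k) //.
  move: nb_t; rewrite /nb_blocks -vE (nb_blocks_forest k) // => ->; rewrite eqxx !andbT /=.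
  (* The length of the word comes for free: starting from one pending tree, it is the total weight
     plus 1. *)
  have /lukasiewiczP[+ _] := luk_w.
  by rewrite (sum_weight n) // size_map addn1 => ->.
case=> wf_t lab_t; rewrite mem_filter mem_words => /and5P[_ _ /eqP nb_t _ perm_w].
have := wf_t; rewrite wfE => /andP[valid_t lab_ok].
split=> //; rewrite ?perm_labels ?perm_w ?lab_t //.
by rewrite -nb_t -(nb_blocks_forest k) // vE.
Qed.

Lemma card_eq_set_seq (T : eqType) (s : seq T) :
  uniq s -> ([set x | x \in s]%classic #= `I_(size s))%card.
Proof.
case: s => [|x0 s].
  have -> : [set x : T | x \in [::]]%classic = classical_sets.set0 by apply/seteqP; split.
  by move=> _; rewrite II0 card_eq00.
move: (x0 :: s) => r uniq_r.
have -> : [set x | x \in r]%classic = [set nth x0 r i | i in `I_(size r)]%classic.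
  apply/seteqP; split=> x /=; last by case=> i lt_i <-; apply: mem_nth.
  by move=> x_r; exists (index x r); [rewrite /= index_mem | rewrite nth_index].
apply: inj_card_eq => i j; rewrite !inE /= => lt_i lt_j /eqP.
by rewrite nth_uniq // => /eqP.
Qed.

(** The map [t] to [encode [:: t]] is a bijection onto the good words, by [encode_inj] and
    [encode_surj]. *)
Lemma card_BT (n : nat) (k : nat -> nat) (m : nat) :
  (forall i, 1 <= i <= n -> 1 <= k i) ->
  (BT n k m #=
   `I_(size (good_words (\sum_(1 <= i < n.+1) (k i - 1)) n k m)))%card.
Proof.
move=> k_ge1; set good := good_words _ n k m.
have uniq_good : uniq good by rewrite filter_uniq ?words_uniq.
have inj_enc : {in BT n k m &, injective (fun t => encode [:: t])}.
  move=> t1 t2; rewrite !inE => /BT_good_words-/(_ k_ge1)[wf1 lab1 _].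
  move=> /BT_good_words-/(_ k_ge1)[wf2 lab2 _] /(encode_inj k).
  by rewrite /= lab1 lab2 => /(_ wf1 wf2 erefl) [].
apply: card_eq_trans (card_eq_set_seq _ _ uniq_good).
rewrite card_eq_sym (_ : [set w | w \in good]%classic =
                         [set encode [:: t] | t in BT n k m]%classic).
  exact: inj_card_eq.
apply/seteqP; split=> w /=; last by case=> t /BT_good_words-/(_ k_ge1)[_ _ ?] <-.
move=> w_good; have := w_good; rewrite mem_filter mem_words.
case/and5P=> luk_w _ _ sorted_w _.
(* Decoding from the stack [[:: 0]] yields a forest with a single tree, whose root is labeled 0. *)
have [F [wf_F lab_F enc_F]] := encode_surj k [:: 0] w luk_w sorted_w.
case: F lab_F wf_F enc_F => [|t [|? ?]] //= [lab_t] wf_t enc_t.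
by exists t => //; apply/BT_good_words; rewrite ?enc_t.
Qed.

Import GRing.Theory Num.Theory.
Local Open Scope ring_scope.

Theorem theorem2p3 (n : nat) (k : nat -> nat) (m : nat)
    (n_ge1 : (1 <= n)%N)
    (k_ge1 : forall i : nat, (1 <= i <= n)%N -> (1 <= k i)%N) :
  let K := (\sum_(1 <= i < n.+1) k i)%N in
  exists2 N : nat,
    (BT n k m #= `I_N)%card &
    N%:R = (m ^ n)%N%:R / (K - n + 1)%N%:R * 'C(K - n + m, m)%:R :> rat.
Proof.
move=> K; have defK : (\sum_(1 <= i < n.+1) (k i - 1) = K - n)%N.
  (* The truncated subtractions are exact because every [k i] in range is at least 1. *)
  rewrite big_nat sumnB; last by move=> i; rewrite ltnS => /k_ge1.
  by rewrite -!big_nat sum_nat_const_nat muln1 subn1.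
exists (size (good_words (K - n) n k m)); first by rewrite -defK; apply: card_BT.
have := card_good_words n k m; rewrite /= defK => eq_card.
rewrite mulrAC -natrM [(m ^ n * _)%N]mulnC -eq_card -addn1 natrM.
by rewrite mulrC mulKr // unitfE pnatr_eq0 addn1.
Qed.
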